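(* Let $(Q,+,\cdot,\le)$ be an ordered field and $n\ge 2$, and assume $n=2$ or that $(Q,+,\cdot,\le)$ is a Euclidean field. Let $$\hat{\mathcal{E}}_{\tau\to\sigma}(p,q):=\exists x\,\exists y\,\exists z\,\big(x\,\tau\,p\wedge x\,\tau\,y\wedge\neg(x\,\tau\,q)\wedge x\neq q\wedge\neg(x\,\tau\,z)\wedge x\neq z\wedge\neg(y\,\tau\,p)\wedge y\neq p\wedge\neg(y\,\tau\,q)\wedge y\neq q\wedge y\,\tau\,z\wedge\neg(z\,\tau\,p)\wedge z\neq p\wedge z\,\tau\,q\big),$$ $$\hat{\mathcal{U}}_{\tau\to\lambda}(p,q):=\neg\hat{\mathcal{E}}_{\tau\to\sigma}(p,q)\wedge p\neq q\wedge\neg(p\,\tau\,q).$$ Then (1) in $(Q^n,\tau)$ the existential formula $\hat{\mathcal{E}}_{\tau\to\sigma}$ (3 quantifiers, 5 variables) defines the relation $\sigma$; and (2) in $(Q^n,\tau)$ the formula $\hat{\mathcal{U}}_{\tau\to\lambda}$ (equivalent to a universal formula with 3 quantifiers) defines the relation $\lambda$.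
   Context: For $p=(p_0,\dots,p_{n-1}),\,q=(q_0,\dots,q_{n-1})\in Q^n$: $p\,\tau\,q$ iff $(p_0-q_0)^2>\sum_{i=1}^{n-1}(p_i-q_i)^2$; $p\,\lambda\,q$ iff $(p_0-q_0)^2=\sum_{i=1}^{n-1}(p_i-q_i)^2$ and $p_0\neq q_0$; $p\,\sigma\,q$ iff $(p_0-q_0)^2<\sum_{i=1}^{n-1}(p_i-q_i)^2$. An ordered field is Euclidean if every nonnegative element is a square. A formula $\varphi(p,q)$ defines $R$ in $(Q^n,\tau)$ if for all $a,b\in Q^n$, $\varphi(a,b)$ holds (symbol $\tau$ interpreted as $\tau$, quantifiers over $Q^n$) iff $(a,b)\in R$. *)

(* Defs.v *)
From mathcomp Require Import all_boot all_order all_algebra.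

Set Implicit Arguments.
Unset Strict Implicit.
Unset Printing Implicit Defensive.

Import Order.TTheory GRing.Theory Num.Theory.
Local Open Scope ring_scope.

Definition euclidean (Q : realFieldType) : Prop :=
  forall x : Q, 0 <= x -> exists y : Q, x = y ^+ 2.

(* Points of Q^n are n-tuples, so that p`_i is the coordinate p_i for i < n;
   the default value 0 of p`_i is never reached when 0 < n. *)
Section MinkowskiRelations.
Variables (Q : realFieldType) (n : nat).
Implicit Types p q : n.-tuple Q.

Definition timelike p q : Prop :=
  \sum_(1 <= i < n) (p`_i - q`_i) ^+ 2 < (p`_0 - q`_0) ^+ 2.

Definition lightlike p q : Prop :=
  (p`_0 - q`_0) ^+ 2 = \sum_(1 <= i < n) (p`_i - q`_i) ^+ 2
  /\ p`_0 <> q`_0.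

Definition spacelike p q : Prop :=
  (p`_0 - q`_0) ^+ 2 < \sum_(1 <= i < n) (p`_i - q`_i) ^+ 2.

End MinkowskiRelations.

(* First-order formulas with equality over one binary relation symbol;
   variables are natural numbers. *)
Inductive formula : Type :=
| Rel of nat & nat
| Eq of nat & nat
| Not of formula
| And of formula & formula
| Or of formula & formula
| Ex of nat & formula
| All of nat & formula.

Declare Scope fo_scope.
Delimit Scope fo_scope with fo.
Bind Scope fo_scope with formula.
Notation "x \tau y" := (Rel x y) (at level 70, no associativity) : fo_scope.
Notation "x \neq y" := (Not (Eq x y))
  (at level 70, no associativity) : fo_scope.
Notation "\not f" := (Not f) (at level 75, right associativity) : fo_scope.
Notation "f \and g" := (And f g) (at level 80, right associativity) : fo_scope.

Definition update (T : Type) (v : nat -> T) (i : nat) (a : T) : nat -> T :=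
  fun j => if j == i then a else v j.

Fixpoint sat (T : Type) (R : T -> T -> Prop) (v : nat -> T) (f : formula) :
    Prop :=
  match f with
  | Rel i j => R (v i) (v j)
  | Eq i j => v i = v j
  | Not g => ~ sat R v g
  | And g h => sat R v g /\ sat R v h
  | Or g h => sat R v g \/ sat R v h
  | Ex i g => exists a : T, sat R (update v i a) g
  | All i g => forall a : T, sat R (update v i a) g
  end.

Definition equivalent (f g : formula) : Prop :=
  forall (T : Type) (R : T -> T -> Prop) (v : nat -> T),
    sat R v f <-> sat R v g.

Fixpoint free_vars (f : formula) : seq nat :=
  match f with
  | Rel i j | Eq i j => [:: i; j]
  | Not g => free_vars g
  | And g h | Or g h => free_vars g ++ free_vars h
  | Ex i g | All i g => [seq j <- free_vars g | j != i]
  end.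

Fixpoint all_vars (f : formula) : seq nat :=
  match f with
  | Rel i j | Eq i j => [:: i; j]
  | Not g => all_vars g
  | And g h | Or g h => all_vars g ++ all_vars h
  | Ex i g | All i g => i :: all_vars g
  end.

Definition num_vars (f : formula) : nat := size (undup (all_vars f)).

Fixpoint num_quantifiers (f : formula) : nat :=
  match f with
  | Rel _ _ | Eq _ _ => 0
  | Not g => num_quantifiers g
  | And g h | Or g h => num_quantifiers g + num_quantifiers h
  | Ex _ g | All _ g => (num_quantifiers g).+1
  end.

Definition quantifier_free (f : formula) : bool := num_quantifiers f == 0%N.

Fixpoint existential (f : formula) : bool :=
  if f is Ex _ g then existential g else quantifier_free f.

Fixpoint universal (f : formula) : bool :=
  if f is All _ g then universal g else quantifier_free f.

(* In a formula phi(p,q), p is the variable 0 and q the variable 1. *)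
Definition var_p : nat := 0.
Definition var_q : nat := 1.

(* phi(a,b) in the structure (T, R); variables other than p get the value b,
   which is immaterial when p and q are the only free variables. *)
Definition holds2 (T : Type) (R : T -> T -> Prop) (f : formula) (a b : T) :
    Prop :=
  sat R (fun i => if i == var_p then a else b) f.

Definition defines (T : Type) (R : T -> T -> Prop) (f : formula)
    (S : T -> T -> Prop) : Prop :=
  {subset free_vars f <= [:: var_p; var_q]} /\
  forall a b : T, holds2 R f a b <-> S a b.

Definition E_tau_sigma : formula :=
  let p := var_p in let q := var_q in
  let x := 2%N in let y := 3%N in let z := 4%N in
  Ex x (Ex y (Ex z
    (x \tau p \and x \tau y
     \and \not (x \tau q) \and x \neq q
     \and \not (x \tau z) \and x \neq z
     \and \not (y \tau p) \and y \neq p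
     \and \not (y \tau q) \and y \neq q
     \and y \tau z
     \and \not (z \tau p) \and z \neq p
     \and z \tau q))).

Definition U_tau_lambda : formula :=
  (\not E_tau_sigma \and var_p \neq var_q \and \not (var_p \tau var_q))%fo.

(* Main.v *)
Require Import Defs.
From mathcomp Require Import all_boot all_order all_algebra.
From mathcomp Require Import ring lra.

(** The five points p - x - y - z - q form a path of timelike pairs, all other
    pairs except possibly (p, q) being distinct and not timelike. By
    transitivity of chronological precedence the time orientation alternates
    along the path, so p and q lie on the same side of x and z respectively; if
    p and q were causally related, the push-up property (p << x and q causally
    before p imply q << x) would make (x, q) or (z, p) timelike. Conversely, for
    p and q spacelike the spatial distance of p and q is in the field, so the
    timelike plane spanned by q - p and the time axis has null coordinates
    (u, v) in which the interval is u * v, and the path is drawn there. *)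

Set Implicit Arguments.
Unset Strict Implicit.
Unset Printing Implicit Defensive.

Import Order.TTheory GRing.Theory Num.Theory.
Local Open Scope ring_scope.

Section MinkowskiGeometry.
Variables (Q : realFieldType) (n : nat).
Implicit Types p q r x y z : n.-tuple Q.

(** * Time orientation along timelike paths *)

Lemma timelike_sym p q : timelike p q -> timelike q p.
Proof.
rewrite /timelike -(sqrrN (p`_0 - q`_0)) opprB.
by under eq_bigr => i _ do rewrite -sqrrN opprB.
Qed.

Lemma timelike_time_neq p q : timelike p q -> p`_0 != q`_0.
Proof.
rewrite /timelike; apply: contraTneq => ->; rewrite subrr expr0n /= -leNgt.
by apply: sumr_ge0 => i _; apply: sqr_ge0.
Qed.

(* The cross term is bounded without Cauchy-Schwarz, expanding
   [0 <= \sum (b * f i - a * g i) ^+ 2] for the time components a and b. *)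
Lemma timelike_pushup p q r :
  timelike p q -> 0 < (p`_0 - q`_0) * (q`_0 - r`_0) ->
  \sum_(1 <= i < n) (q`_i - r`_i) ^+ 2 <= (q`_0 - r`_0) ^+ 2 ->
  timelike p r.
Proof.
rewrite /timelike; set a := p`_0 - q`_0; set b := q`_0 - r`_0.
have -> : p`_0 - r`_0 = a + b by rewrite /a /b; ring.
set F := \sum_(1 <= i < n) _ => ltF ab0.
set G := \sum_(1 <= i < n) (q`_i - r`_i) ^+ 2 => leG.
pose S := \sum_(1 <= i < n) (p`_i - q`_i) * (q`_i - r`_i).
have -> : \sum_(1 <= i < n) (p`_i - r`_i) ^+ 2 = F + G + 2 * S.
  rewrite /F /G /S mulr_sumr -!big_split /=.
  by apply: eq_bigr => i _; ring.
have ge0 : 0 <= b ^+ 2 * F + a ^+ 2 * G - 2 * (a * b) * S.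
  have -> : b ^+ 2 * F + a ^+ 2 * G - 2 * (a * b) * S =
      \sum_(1 <= i < n) (b * (p`_i - q`_i) - a * (q`_i - r`_i)) ^+ 2.
    rewrite /F /G /S !mulr_sumr -big_split /= -sumrB.
    by apply: eq_bigr => i _; ring.
  by apply: sumr_ge0 => i _; apply: sqr_ge0.
have b0 : 0 < b ^+ 2.
  by rewrite exprn_even_gt0 //=; apply: contraTneq ab0 => ->; rewrite mulr0 ltxx.
have ltbF : b ^+ 2 * F < b ^+ 2 * a ^+ 2 by rewrite ltr_pM2l.
have leaG : a ^+ 2 * G <= a ^+ 2 * b ^+ 2 by rewrite ler_wpM2l ?sqr_ge0.
have ltS : S < a * b by rewrite -(ltr_pM2l ab0); lra.
by rewrite sqrrD -mulr_natl; lra.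
Qed.

(** Contrapositive of [timelike_pushup]; a zero product is excluded because both pairs have distinct
    times. *)
Lemma not_timelike_time_opposite p q r :
  timelike p q -> ~ timelike p r -> q`_0 != r`_0 ->
  \sum_(1 <= i < n) (q`_i - r`_i) ^+ 2 <= (q`_0 - r`_0) ^+ 2 ->
  (p`_0 - q`_0) * (q`_0 - r`_0) < 0.
Proof.
move=> pq Npr qr leqr; rewrite ltNge le_eqVlt negb_or; apply/andP; split.
  by rewrite eq_sym mulf_neq0 // subr_eq0 // timelike_time_neq.
by apply/negP => lt0; apply/Npr/(timelike_pushup pq).
Qed.

Lemma timelike_path_alternates p q r :
  timelike p q -> timelike q r -> ~ timelike p r ->
  (p`_0 - q`_0) * (q`_0 - r`_0) < 0.
Proof.
move=> pq qr Npr; apply: not_timelike_time_opposite pq Npr _ (ltW qr).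
exact: timelike_time_neq.
Qed.

Lemma nontimelike_simultaneous_eq p q :
  (0 < n)%N -> p`_0 = q`_0 ->
  \sum_(1 <= i < n) (p`_i - q`_i) ^+ 2 <= (p`_0 - q`_0) ^+ 2 -> p = q.
Proof.
move=> n0 e0; rewrite e0 subrr expr0n /= => le0.
have ge0 i : true -> 0 <= (p`_i - q`_i) ^+ 2 by rewrite sqr_ge0.
have /eqP : \sum_(1 <= i < n) (p`_i - q`_i) ^+ 2 = 0.
  by apply/eqP; rewrite eq_le le0 sumr_ge0.
rewrite psumr_eq0 // => /allP eq0.
apply/val_inj/(@eq_from_nth _ 0); rewrite !size_tuple // => -[//|i] lti.
have := eq0 i.+1; rewrite mem_index_iota lti => /(_ isT).
by rewrite sqrf_eq0 subr_eq0 => /eqP.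
Qed.

Lemma spacelike_of_timelike_path p q x y z :
  (0 < n)%N -> p <> q ->
  timelike x p -> timelike x y -> timelike y z -> timelike z q ->
  ~ timelike x q -> ~ timelike x z -> ~ timelike y p -> ~ timelike y q ->
  ~ timelike z p -> spacelike p q.
Proof.
move=> n0 npq xp xy yz zq Nxq Nxz Nyp Nyq Nzp; rewrite /spacelike ltNge.
apply/negP => lepq.
have pq0 : p`_0 != q`_0.
  by apply: contra_notN npq => /eqP /nontimelike_simultaneous_eq; apply.
have leqp : \sum_(1 <= i < n) (q`_i - p`_i) ^+ 2 <= (q`_0 - p`_0) ^+ 2.
  rewrite -sqrrN opprB; apply: le_trans lepq; apply: ler_sum => i _.
  by rewrite -sqrrN opprB.
have lt1 := not_timelike_time_opposite xp Nxq pq0 lepq.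
have lt2 : (z`_0 - q`_0) * (q`_0 - p`_0) < 0.
  by apply: not_timelike_time_opposite zq Nzp _ leqp; rewrite eq_sym.
have lt3 := timelike_path_alternates (timelike_sym xy) xp Nyp.
have lt4 := timelike_path_alternates xy yz Nxz.
have lt5 := timelike_path_alternates yz zq Nyq.
set a := x`_0 - p`_0 in lt1 lt3; set b := p`_0 - q`_0 in lt1.
set c := y`_0 - x`_0 in lt3; set d := y`_0 - z`_0 in lt4 lt5.
set e := z`_0 - q`_0 in lt2 lt5.
(* Around the cycle [x], [p], [q], [z], [y], consecutive time differences have opposite signs. Five
   negative products multiply to a negative number, yet each difference occurs in two of them, so
   the result is a square. *)
have sq_lt0 : (a * b * c * d * e) ^+ 2 < 0.
  have -> : (a * b * c * d * e) ^+ 2 =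
      (a * b) * (e * (q`_0 - p`_0)) * ((c * a) * ((x`_0 - y`_0) * d)) * (d * e).
    by rewrite /b /c; ring.
  by rewrite pmulr_rlt0 // mulr_gt0 // nmulr_rgt0.
by have := sqr_ge0 (a * b * c * d * e); rewrite leNgt sq_lt0.
Qed.

(** * Null coordinates and construction of the path *)

(* The point of the timelike plane through p and q whose offset from p has null
   coordinates u and v, where s is the spatial distance of p and q. *)
Definition null_point p q (s u v : Q) : n.-tuple Q :=
  [tuple of mkseq (fun i => if i == 0%N then p`_0 + (u + v) / 2
                            else p`_i + (u - v) / (2 * s) * (q`_i - p`_i)) n].

Section NullCoordinates.
Variables (p q : n.-tuple Q) (s : Q).
Hypotheses (n_gt0 : (0 < n)%N) (s_gt0 : 0 < s).
Hypothesis s_dist : s ^+ 2 = \sum_(1 <= i < n) (p`_i - q`_i) ^+ 2.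

Lemma null_point_time u v : (null_point p q s u v)`_0 = p`_0 + (u + v) / 2.
Proof. by rewrite nth_mkseq. Qed.

Lemma null_point_origin : null_point p q s 0 0 = p.
Proof.
apply/val_inj/(@eq_from_nth _ 0); rewrite !size_tuple // => i lti.
rewrite nth_mkseq // addr0 subr0 !mul0r !addr0.
by case: i lti.
Qed.

Lemma null_point_target :
  null_point p q s (q`_0 - p`_0 + s) (q`_0 - p`_0 - s) = q.
Proof.
apply/val_inj/(@eq_from_nth _ 0); rewrite !size_tuple // => i lti.
rewrite nth_mkseq //; case: i lti => [|i] _ /=; first by field.
by field; rewrite gt_eqF.
Qed.

(** With [du = u - u'] and [dv = v - v'], the time offset is [(du + dv) / 2] and the spatial one has
    length [|du - dv| / 2]; the difference of squares factors. *)
Lemma null_point_interval u v u' v' :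
  ((null_point p q s u v)`_0 - (null_point p q s u' v')`_0) ^+ 2 -
  \sum_(1 <= i < n)
    ((null_point p q s u v)`_i - (null_point p q s u' v')`_i) ^+ 2 =
  (u - u') * (v - v').
Proof.
rewrite !null_point_time.
have -> : \sum_(1 <= i < n)
    ((null_point p q s u v)`_i - (null_point p q s u' v')`_i) ^+ 2 =
    (((u - v) - (u' - v')) / (2 * s)) ^+ 2 * s ^+ 2.
  rewrite s_dist mulr_sumr !big_nat; apply: eq_bigr => -[//|i] /andP[_ lti].
  by rewrite !nth_mkseq //=; field; rewrite gt_eqF.
by field; rewrite gt_eqF.
Qed.

Lemma null_point_timelike u v u' v' :
  0 < (u - u') * (v - v') ->
  timelike (null_point p q s u v) (null_point p q s u' v').
Proof. by rewrite -null_point_interval subr_gt0. Qed.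

Lemma null_point_spacelike u v u' v' :
  (u - u') * (v - v') < 0 ->
  spacelike (null_point p q s u v) (null_point p q s u' v').
Proof. by rewrite -null_point_interval subr_lt0. Qed.

End NullCoordinates.

Lemma spacelike_not_timelike p q : spacelike p q -> ~ timelike p q.
Proof. by rewrite /spacelike /timelike => /lt_gtF ->. Qed.

Lemma spacelike_neq p q : spacelike p q -> p <> q.
Proof.
rewrite /spacelike => + pq; rewrite pq ltNge subrr expr0n /= big1 ?lexx // => i _.
by rewrite subrr expr0n.
Qed.

(** For [n = 2] the sum has a single term, whose root is explicit; otherwise the root comes from the
    Euclidean axiom. *)
Lemma spatial_distance p q :
  (0 < n)%N -> n = 2%N \/ euclidean Q -> spacelike p q ->
  exists2 s : Q, 0 < s & s ^+ 2 = \sum_(1 <= i < n) (p`_i - q`_i) ^+ 2.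
Proof.
move=> n0 hQ /(le_lt_trans (sqr_ge0 _)) sum_gt0.
suff [s sE] : exists s, s ^+ 2 = \sum_(1 <= i < n) (p`_i - q`_i) ^+ 2.
  exists `|s|; last by rewrite real_normK ?num_real.
  by rewrite normr_gt0 -sqrf_eq0 sE gt_eqF.
case: hQ => [n2|eucl].
  by exists (p`_1 - q`_1); rewrite big_ltn ?n2 // big_geq ?n2 // addr0.
by have [s sE] := eucl _ (ltW sum_gt0); exists s.
Qed.

Lemma spacelike_timelike_path p q :
  (0 < n)%N -> n = 2%N \/ euclidean Q -> spacelike p q ->
  exists x y z, [/\ timelike x p, timelike x y, timelike y z & timelike z q] /\
    [/\ spacelike x q, spacelike x z, spacelike y p, spacelike y q
      & spacelike z p].
Proof.
move=> n0 hQ pq; have [s s0 sE] := spatial_distance n0 hQ pq.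
(* The null coordinates of [q] relative to [p] are [(a, - b)]. Both [a] and [b] are positive, having
   product [s ^+ 2 - (q]_0 - p[_0) ^+ 2] and sum [2 * s]. *)
set a := q`_0 - p`_0 + s; set b := s - (q`_0 - p`_0).
have : (q`_0 - p`_0) ^+ 2 < s ^+ 2 by rewrite sE -sqrrN opprB.
rewrite -subr_gt0 => ab0.
have {ab0} [a0 b0] : 0 < a /\ 0 < b.
  have : 0 < a * b by move: ab0; rewrite /a /b; nra.
  have : 0 < a + b by rewrite /a /b; lra.
  by split; nra.
have ab0 : 0 < a * b by rewrite mulr_gt0.
pose N := null_point p q s.
have pE : N 0 0 = p by apply: null_point_origin.
have qE : N a (- b) = q by rewrite /b opprB; apply: null_point_target.
have T u v u' v' : 0 < (u - u') * (v - v') -> timelike (N u v) (N u' v').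
  exact: null_point_timelike.
have S u v u' v' : (u - u') * (v - v') < 0 -> spacelike (N u v) (N u' v').
  exact: null_point_spacelike.
(* The point [y] is the midpoint of [p] and [q]; [x] and [z] are the midpoints of [p], [y] and of
   [y], [q], shifted to the future by [(a / 2, b / 2)]. *)
exists (N (3 * a / 4) (b / 4)), (N (a / 2) (- b / 2)),
  (N (5 * a / 4) (- b / 4)).
by rewrite -pE -qE; do 2!split; first [apply: T; nra | apply: S; nra].
Qed.

End MinkowskiGeometry.

(** * Semantics of the two formulas *)

Lemma sat_E_tau_sigma (T : Type) (R : T -> T -> Prop) (v : nat -> T) :
  sat R v E_tau_sigma <-> exists x y z,
    R x (v 0%N) /\ R x y /\ ~ R x (v 1%N) /\ x <> v 1%N /\ ~ R x z /\ x <> z /\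
    ~ R y (v 0%N) /\ y <> v 0%N /\ ~ R y (v 1%N) /\ y <> v 1%N /\ R y z /\
    ~ R z (v 0%N) /\ z <> v 0%N /\ R z (v 1%N).
Proof. by []. Qed.

Lemma holds_E_tau_sigma (Q : realFieldType) n (p q : n.-tuple Q) :
  (0 < n)%N -> n = 2%N \/ euclidean Q ->
  holds2 (@timelike Q n) E_tau_sigma p q <-> spacelike p q.
Proof.
move=> n0 hQ; rewrite /holds2 sat_E_tau_sigma /=; split.
  move=> [x [y [z]]].
  move=> [xp [xy [Nxq [_ [Nxz [_ [Nyp [_ [Nyq [_ [yz [Nzp [_ zq]]]]]]]]]]]]].
  apply: (@spacelike_of_timelike_path _ _ p q x y z) => // epq.
  by apply: Nxq; rewrite -epq.
move=> /(spacelike_timelike_path n0 hQ) [x [y [z]]].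
move=> [[xp xy yz zq] [xq xz yp yq zp]]; exists x, y, z.
by do !split=> //; first [apply: spacelike_not_timelike | apply: spacelike_neq].
Qed.

Lemma lightlike_iff (Q : realFieldType) n (p q : n.-tuple Q) :
  (0 < n)%N ->
  lightlike p q <-> ~ spacelike p q /\ p <> q /\ ~ timelike p q.
Proof.
move=> n0; split=> [[e ne]|[/negP Ns [npq /negP Nt]]].
  rewrite /spacelike /timelike e ltxx; split=> //; split=> // epq.
  by apply: ne; rewrite epq.
rewrite -!leNgt in Ns Nt; have e := le_anti (introT andP (conj Nt Ns)).
(* Equal times would make all spatial differences vanish, hence [p = q]. *)
by split=> // e0; apply/npq/nontimelike_simultaneous_eq.
Qed.

Definition E_tau_sigma_matrix : formula :=
  if E_tau_sigma is Ex _ (Ex _ (Ex _ f)) then f else E_tau_sigma.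

Definition U_tau_lambda_prenex : formula :=
  All 2 (All 3 (All 4 (\not E_tau_sigma_matrix \and var_p \neq var_q
                         \and \not (var_p \tau var_q))%fo)).

Lemma equivalent_U_tau_lambda : equivalent U_tau_lambda U_tau_lambda_prenex.
Proof.
move=> T R v; split=> [[NE [npq Npq]] x y z|H].
  by split=> [m|//]; apply: NE; exists x, y, z.
(* The quantifier-free conjuncts come from any instance; [v 0] witnesses that the domain is
   inhabited. *)
have [_ npq] := H (v 0%N) (v 0%N) (v 0%N).
by split=> // -[x [y [z m]]]; have [Nm _] := H x y z.
Qed.

Theorem theorem4p7 (Q : realFieldType) (n : nat) (hn : (2 <= n)%N)
    (hQ : n = 2%N \/ euclidean Q) :
  (existential E_tau_sigma /\ num_quantifiers E_tau_sigma = 3%N /\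
   num_vars E_tau_sigma = 5%N /\
   defines (@timelike Q n) E_tau_sigma (@spacelike Q n)) /\
  (defines (@timelike Q n) U_tau_lambda (@lightlike Q n) /\
   exists f : formula,
     universal f /\ num_quantifiers f = 3%N /\ equivalent U_tau_lambda f).
Proof.
have n0 : (0 < n)%N := ltnW hn.
split.
  split=> //; split=> //; split=> //; split=> [|p q]; first exact/allP.
  exact: holds_E_tau_sigma.
split; last first.
  exists U_tau_lambda_prenex; split=> //; split=> //.
  exact: equivalent_U_tau_lambda.
split=> [|p q]; first exact/allP.
rewrite lightlike_iff // -(holds_E_tau_sigma p q n0 hQ).
exact: iff_refl.
Qed.
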